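(* Let $R$ and $R'$ be commutative unital rings, $f:\mathcal{S}\to\mathcal{T}$ a simplicially enriched functor between simplicially enriched categories, and $n\in\mathbb{N}$. Then $f$ induces a functorial $R$-$R'$-bimodule morphism $$f_*:C_n(R,\mathcal{S},R')\to C_n(R,\mathcal{T},R'),$$ sending each basis simplex to its image under $f$. Moreover, if $f$ is injective on objects, then: 1) $f$ induces algebra morphisms $f_R:R[\mathcal{S}]\to R[\mathcal{T}]$ and $f_S:R'[\mathcal{S}]\to R'[\mathcal{T}]$ (the $R$-linear, respectively $R'$-linear, maps sending each $1$-morphism $t$ to $f(t)$). 2) For any $a\in R[\mathcal{S}]$, $b\in R'[\mathcal{S}]$ and $m\in C_n(R,\mathcal{S},R')$, $$f_*(a.m)=f_R(a).f_*(m),\qquad f_*(m.b)=f_*(m).f_S(b).$$ 3) $f_R$ and $f_S$ are functorial in $f$.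
   Context: A simplicially enriched category $\mathcal{S}$ (with a set of objects) is a category enriched over simplicial sets: hom-objects $\mathcal{S}(A,B)$ are simplicial sets and composition $\mathcal{S}(A,B)\times\mathcal{S}(B,C)\to\mathcal{S}(A,C)$, $(f,g)\mapsto g\circ f$, is a simplicial map, with restriction $\circ_n$ to $n$-simplices. A $1$-morphism $X\to Y$ is a $0$-simplex of $\mathcal{S}(X,Y)$. A simplicially enriched functor is an enriched functor (simplicial maps on hom-objects). For a commutative unital ring $R$, the path algebra $R[\mathcal{S}]$ is the free left $R$-module on all $1$-morphisms, with $R$-bilinear product determined, for $f:X\to Y$, $g:Z\to T$, by $g\times f=g\circ_0 f$ if $Z=Y$ and $0$ otherwise; it is a (generally non-unital) $R$-algebra. Algebra morphisms are linear multiplicative maps. $C_n(R,\mathcal{S},R')$ is the free $R$-$R'$-bimodule (direct sum of copies of $R\otimes_{\mathbb{Z}}R'$) on the set $\bigcup_{A,B}(\mathcal{S}(A,B))_n$. It carries the $R[\mathcal{S}]$-$R'[\mathcal{S}]$-bimodule structure determined, for $1$-morphisms $f:X\to Y$, $g:U\to V$ and $\sigma\in(\mathcal{S}(A,B))_n$, by $f.\sigma.g=0$ if $V\ne A$ or $B\ne X$, and $f.\sigma.g=(s_{n-1}\cdots s_0)(f)\circ_n\sigma\circ_n(s_{n-1}\cdots s_0)(g)$ otherwise, where $s_k$ are degeneracy operators. Functoriality means compatibility with composition of functors and identities, e.g. $(gf)_*=g_*f_*$ (and, for functors injective on objects, $(gf)_R=g_Rf_R$, $(gf)_S=g_Sf_S$).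 *)

(* Defs.v *)
From HB Require Import structures.
From mathcomp Require Import all_boot all_order all_algebra.
From mathcomp Require Import finmap boolp.
From mathcomp Require Import monalg.
From mathcomp Require Import zify.

Set Implicit Arguments.
Unset Strict Implicit.
Unset Printing Implicit Defensive.

Import GRing.Theory.
Local Open Scope ring_scope.

(* [m] is modelled by the ordinal 'I_m.+1; [sact h] is the contravariant
   action of the order-preserving map h. *)
Record sset := SSet {
  sx :> nat -> Type;
  sact : forall m n, {omorphism 'I_m.+1 -> 'I_n.+1} -> sx n -> sx m;
  sact_id : forall n (x : sx n), sact idfun x = x;
  sact_comp : forall l m n (h : {omorphism 'I_m.+1 -> 'I_n.+1})
      (k : {omorphism 'I_l.+1 -> 'I_m.+1}) (x : sx n),
    sact (h \o k) x = sact k (sact h x) }.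

Lemma codegen_subproof n (k : 'I_n.+1) (i : 'I_n.+2) : (unbump k i < n.+1)%N.
Proof.
rewrite /unbump; have := ltn_ord i; have := ltn_ord k.
by case: (ltnP k i) => /=; lia.
Qed.

(* The surjection [n+1] -> [n] hitting k twice. *)
Definition codegen n (k : 'I_n.+1) (i : 'I_n.+2) : 'I_n.+1 :=
  Ordinal (codegen_subproof k i).

Lemma codegen_homo n (k : 'I_n.+1) : {homo codegen k : i j / (i <= j)%O}.
Proof.
move=> i j; rewrite !leEord /= /unbump.
by case: (ltnP k i) => /=; case: (ltnP k j) => /=; lia.
Qed.

HB.instance Definition _ n (k : 'I_n.+1) :=
  Order.isOrderMorphism.Build _ _ _ _ (codegen k) (@codegen_homo n k).

Definition sdeg (X : sset) n (k : 'I_n.+1) : X n -> X n.+1 :=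
  @sact X _ _ (codegen k).

Record smap (X Y : sset) := SMap {
  smap_fun :> forall n, X n -> Y n;
  smap_nat : forall m n (h : {omorphism 'I_m.+1 -> 'I_n.+1}) (x : X n),
    smap_fun (sact h x) = sact h (smap_fun x) }.

Definition sprod (X Y : sset) : sset.
Proof.
refine (@SSet (fun n => (X n * Y n)%type)
          (fun m n h x => (sact h x.1, sact h x.2)) _ _).
- by move=> n [x y]; rewrite !sact_id.
- by move=> l m n h k [x y]; rewrite !sact_comp.
Defined.

Definition spt : sset :=
  @SSet (fun _ => unit) (fun _ _ _ x => x)
    (fun _ _ => erefl) (fun _ _ _ _ _ _ => erefl).

(* The unit of the enrichment is the terminal simplicial set, so that
   [seid A n tt] is the n-fold degeneracy of the identity 0-simplex of A.
   Composition takes its arguments in diagrammatic order: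
   [secomp A B C n (f, g)] is g o_n f. *)
Record secat := SECat {
  ob : Type;
  hom : ob -> ob -> sset;
  secomp : forall A B C, smap (sprod (hom A B) (hom B C)) (hom A C);
  seid : forall A, smap spt (hom A A);
  secompA : forall A B C D n (f : hom A B n) (g : hom B C n) (h : hom C D n),
    secomp A C D n (secomp A B C n (f, g), h) =
    secomp A B D n (f, secomp B C D n (g, h));
  secomp1f : forall A B n (f : hom A B n), secomp A A B n (seid A n tt, f) = f;
  secompf1 : forall A B n (f : hom A B n), secomp A B B n (f, seid B n tt) = f }.

Record sefun (S T : secat) := SEFun {
  fob :> ob S -> ob T;
  fhom : forall A B, smap (hom A B) (hom (fob A) (fob B));
  fhom_comp : forall A B C n (f : hom A B n) (g : hom B C n),
    fhom A C n (secomp A B C n (f, g)) =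
    secomp (fob A) (fob B) (fob C) n (fhom A B n f, fhom B C n g);
  fhom_id : forall A n, fhom A A n (seid A n tt) = seid (fob A) n tt }.

Definition smap_id (X : sset) : smap X X :=
  @SMap X X (fun _ x => x) (fun _ _ _ _ => erefl).

Definition smap_comp (X Y Z : sset) (q : smap Y Z) (p : smap X Y) : smap X Z.
Proof.
by refine (@SMap X Z (fun n x => q n (p n x)) _) => m n h x; rewrite !smap_nat.
Defined.

Definition sefun_id (S : secat) : sefun S S :=
  @SEFun S S (fun A => A) (fun A B => smap_id (hom A B))
    (fun _ _ _ _ _ _ => erefl) (fun _ _ => erefl).

Definition sefun_comp (S T U : secat) (g : sefun T U) (f : sefun S T) :
  sefun S U.
Proof.
refine (@SEFun S U (fun A => g (f A))
          (fun A B => smap_comp (fhom g (f A) (f B)) (fhom f A B)) _ _).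
- by move=> A B C n p q /=; rewrite !fhom_comp.
- by move=> A n /=; rewrite !fhom_id.
Defined.

(* The disjoint union over all pairs (A, B) of the n-simplices of hom A B;
   the 1-morphisms of S form [simplex S 0]. *)
Record simplex (S : secat) (n : nat) := Simplex {
  sdom : ob S;
  scod : ob S;
  sval : hom sdom scod n }.

HB.instance Definition _ (S : secat) (n : nat) := gen_eqMixin (simplex S n).
HB.instance Definition _ (S : secat) (n : nat) := gen_choiceMixin (simplex S n).

(* g o_n f, undefined unless f ends where g starts. *)
Definition simplex_comp (S : secat) n (g f : simplex S n) :
    option (simplex S n) :=
  match pselect (scod f = sdom g) with
  | left e =>
      Some (Simplex (secomp (sdom f) (sdom g) (scod g) n
        (eq_rect _ (fun B => hom (sdom f) B n) (sval f) _ e, sval g)))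
  | right _ => None
  end.

(* s_{n-1} ... s_0 *)
Fixpoint deg_iter (X : sset) (n : nat) : X 0 -> X n :=
  match n with
  | 0 => fun x => x
  | p.+1 => fun x => sdeg ord_max (@deg_iter X p x)
  end.

Definition simplex_deg (S : secat) n (f : simplex S 0) : simplex S n :=
  Simplex (deg_iter n (sval f)).

Definition simplex_map (S T : secat) (f : sefun S T) n (s : simplex S n) :
    simplex T n :=
  Simplex (fhom f (sdom s) (scod s) n (sval s)).

Lemma simplex_compE (S : secat) n (A B C : ob S) (f : hom A B n) (g : hom B C n) :
  simplex_comp (Simplex g) (Simplex f) = Some (Simplex (secomp A B C n (f, g))).
Proof.
rewrite /simplex_comp /=; case: pselect => // e.
by rewrite (Prop_irrelevance e erefl).
Qed.

Lemma simplex_compN (S : secat) n (g f : simplex S n) :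
  scod f <> sdom g -> simplex_comp g f = None.
Proof. by rewrite /simplex_comp; case: pselect. Qed.

Lemma simplex_compA (S : secat) n (h g f : simplex S n) :
  obind (fun x => simplex_comp h x) (simplex_comp g f) =
  obind (fun x => simplex_comp x f) (simplex_comp h g).
Proof.
case: h g f => [C D h] [B' C' g] [A B f].
have [eB|nB] := pselect (B = B'); last first.
  rewrite (@simplex_compN _ _ (Simplex g) (Simplex f) nB) /=.
  have [eC|nC] := pselect (C' = C).
    by case: C / eC h => h; rewrite simplex_compE /= simplex_compN.
  by rewrite (@simplex_compN _ _ (Simplex h) (Simplex g) nC).
case: B' / eB g => g; rewrite simplex_compE /=.
have [eC|nC] := pselect (C' = C).
  by case: C / eC h => h; rewrite !simplex_compE /= simplex_compE secompA.
by rewrite !simplex_compN.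
Qed.

Lemma deg_iter_comp (S : secat) (A B C : ob S) n (f : hom A B 0) (g : hom B C 0) :
  deg_iter n (secomp A B C 0 (f, g)) =
  secomp A B C n (deg_iter n f, deg_iter n g).
Proof. by elim: n => //= n ->; rewrite /sdeg -smap_nat. Qed.

Lemma simplex_comp_deg (S : secat) n (g f : simplex S 0) :
  simplex_comp (simplex_deg n g) (simplex_deg n f) =
  omap (simplex_deg n) (simplex_comp g f).
Proof.
case: g f => [B' C g] [A B f]; have [e|ne] := pselect (B = B'); last first.
  by rewrite !simplex_compN.
by case: B' / e g => g; rewrite !simplex_compE /= /simplex_deg /= deg_iter_comp.
Qed.

Section AdditiveExtension.
Variables (K : choiceType) (G V : zmodType).
Implicit Types (F : K -> G -> V) (u v : {malg G[K]}).

(* The additive map << x *g k >> |-> F k x, when each F k is additive. *)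
Definition mext F u : V := \sum_(k <- msupp u) F k u@_k.

Lemma mextw F u (d : {fset K}) : (forall k, additive (F k)) ->
  (msupp u `<=` d)%fset -> mext F u = \sum_(k <- d) F k u@_k.
Proof.
move=> Fadd le_ud; apply: big_fset_incl => // k _ /mcoeff_outdom ->.
by rewrite -(subrr 0) Fadd subrr.
Qed.

Lemma mextB F : (forall k, additive (F k)) -> additive (mext F).
Proof.
move=> Fadd u v; pose d := (msupp u `|` msupp v)%fset.
rewrite (@mextw F (u - v) d) ?msuppB_le // (@mextw F u d) ?fsubsetUl //.
rewrite (@mextw F v d) ?fsubsetUr // -sumrB; apply: eq_bigr => k _.
by rewrite mcoeffB Fadd.
Qed.

Lemma mextU F k x : (forall k, additive (F k)) -> mext F << x *g k >> = F k x.
Proof.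
by move=> Fadd; rewrite (mextw Fadd msuppU_le) big_seq_fset1 mcoeffUU.
Qed.

Lemma malg_additive_ext (f g : {malg G[K]} -> V) : additive f -> additive g ->
  (forall k x, f << x *g k >> = g << x *g k >>) -> f =1 g.
Proof.
move=> fB gB eqfg u.
pose f' := GRing.isAdditive.Build _ _ f fB.
pose g' := GRing.isAdditive.Build _ _ g gB.
pose fA : {additive _ -> _} := HB.pack f f'.
pose gA : {additive _ -> _} := HB.pack g g'.
rewrite (monalgE u) -[f]/(fA : _ -> _) -[g]/(gA : _ -> _) !raddf_sum.
by apply: eq_bigr => k _; apply: eqfg.
Qed.

End AdditiveExtension.

Lemma monalgU_additive (K : choiceType) (G : zmodType) (k : K) :
  additive (fun x : G => << x *g k >>).
Proof. exact: monalgU_is_additive. Qed.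

(* << x *g k >> |-> << x *g h k >> *)
Definition mpush (G : zmodType) (K K' : choiceType) (h : K -> K') :
    {malg G[K]} -> {malg G[K']} :=
  mext (fun k x => << x *g h k >>).

(* << x *g k >> |-> << phi x *g k >> *)
Definition mcmap (G H : zmodType) (K : choiceType) (phi : G -> H) :
    {malg G[K]} -> {malg H[K]} :=
  mext (fun k x => << phi x *g k >>).

Definition monalgO (G : zmodType) (K : choiceType) (o : option K) (x : G) :
    {malg G[K]} :=
  if o is Some k then << x *g k >> else 0.

(* (<< x *g k >>, << y *g l >>) |-> << mu x y *g o k l >>, read as 0 when
   o k l is undefined *)
Definition mconv (G1 G2 G3 : zmodType) (K1 K2 K3 : choiceType)
    (mu : G1 -> G2 -> G3) (o : K1 -> K2 -> option K3)
    (a : {malg G1[K1]}) (b : {malg G2[K2]}) : {malg G3[K3]} :=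
  mext (fun k x => mext (fun l y => monalgO (o k l) (mu x y)) b) a.

Lemma monalgO_additive (G : zmodType) (K : choiceType) (o : option K) :
  additive (@monalgO G K o).
Proof.
by case: o => [k|] x y /=; [exact: monalgU_additive | rewrite subr0].
Qed.

Section Convolution.
Variables (G1 G2 G3 : zmodType) (K1 K2 K3 : choiceType).
Variables (mu : G1 -> G2 -> G3) (o : K1 -> K2 -> option K3).
Hypothesis mul_additive : forall y, additive (fun x => mu x y).
Hypothesis mur_additive : forall x, additive (mu x).

Let addl k x : forall l, additive (fun y => monalgO (o k l) (mu x y)).
Proof. by move=> l y z; rewrite mur_additive monalgO_additive. Qed.

Let addr b k :
  additive (fun x => mext (fun l y => monalgO (o k l) (mu x y)) b).
Proof.
move=> x y; rewrite /mext -sumrB; apply: eq_bigr => l _.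
by rewrite mul_additive monalgO_additive.
Qed.

Lemma mconvBl b : additive (fun a => mconv mu o a b).
Proof. by apply: mextB => k; apply: addr. Qed.

Lemma mconvBr a : additive (mconv mu o a).
Proof.
move=> b c; rewrite /mconv /mext -sumrB; apply: eq_bigr => k _.
exact: (mextB (addl k a@_k) b c).
Qed.

Lemma mconvUU k x l y :
  mconv mu o << x *g k >> << y *g l >> = monalgO (o k l) (mu x y).
Proof. by rewrite /mconv mextU ?mextU. Qed.

Lemma mconvOO k x l y :
  mconv mu o (monalgO k x) (monalgO l y) =
  monalgO (obind (fun k => obind (o k) l) k) (mu x y).
Proof.
have z0 b : mconv mu o 0 b = 0.
  by have := mconvBl b 0 0; rewrite !subrr.
have z0' a : mconv mu o a 0 = 0.
  by have := mconvBr a 0 0; rewrite !subrr.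
case: k l => [k|] [l|] /=; rewrite ?z0 ?z0' //.
exact: mconvUU.
Qed.

End Convolution.

Lemma additive_comp (U V W : zmodType) (f : V -> W) (g : U -> V) :
  additive f -> additive g -> additive (fun x => f (g x)).
Proof. by move=> fB gB x y; rewrite gB fB. Qed.

Lemma additiveD (U V : zmodType) (f : U -> V) :
  additive f -> {morph f : x y / x + y}.
Proof.
move=> fB x y; pose f' := GRing.isAdditive.Build _ _ f fB.
pose fA : {additive U -> V} := HB.pack f f'.
exact: (raddfD fA).
Qed.

Lemma morphD_additive (U V : zmodType) (f : U -> V) :
  {morph f : x y / x + y} -> additive f.
Proof.
move=> fD x y; apply/eqP; rewrite eq_sym subr_eq -fD; apply/eqP.
by rewrite subrK.
Qed.

Lemma mconvA (G1 G2 G3 G12 G23 G : zmodType)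
    (K1 K2 K3 K12 K23 K : choiceType)
    (m12 : G1 -> G2 -> G12) (o12 : K1 -> K2 -> option K12)
    (m23 : G2 -> G3 -> G23) (o23 : K2 -> K3 -> option K23)
    (ml : G12 -> G3 -> G) (ol : K12 -> K3 -> option K)
    (mr : G1 -> G23 -> G) (or : K1 -> K23 -> option K) :
  (forall y, additive (fun x => m12 x y)) -> (forall x, additive (m12 x)) ->
  (forall y, additive (fun x => m23 x y)) -> (forall x, additive (m23 x)) ->
  (forall y, additive (fun x => ml x y)) -> (forall x, additive (ml x)) ->
  (forall y, additive (fun x => mr x y)) -> (forall x, additive (mr x)) ->
  (forall x y z, mr x (m23 y z) = ml (m12 x y) z) ->
  (forall k l p, obind (or k) (o23 l p) = obind (fun q => ol q p) (o12 k l)) ->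
  forall a b c,
  mconv mr or a (mconv m23 o23 b c) = mconv ml ol (mconv m12 o12 a b) c.
Proof.
move=> m12l m12r m23l m23r mll mlr mrl mrr mA oA a b c.
apply: (@malg_additive_ext _ _ _
  (fun a => mconv mr or a (mconv m23 o23 b c))
  (fun a => mconv ml ol (mconv m12 o12 a b) c) _ _ _ a) => [||k x].
- exact: mconvBl.
- exact: (additive_comp (mconvBl ol mll c) (mconvBl o12 m12l b)).
apply: (@malg_additive_ext _ _ _
  (fun b => mconv mr or << x *g k >> (mconv m23 o23 b c))
  (fun b => mconv ml ol (mconv m12 o12 << x *g k >> b) c) _ _ _ b) => [||l y].
- exact: (additive_comp (mconvBr or mrr _) (mconvBl o23 m23l c)).
- exact: (additive_comp (mconvBl ol mll c) (mconvBr o12 m12r _)).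
apply: (@malg_additive_ext _ _ _
  (fun c => mconv mr or << x *g k >> (mconv m23 o23 << y *g l >> c))
  (fun c => mconv ml ol (mconv m12 o12 << x *g k >> << y *g l >>) c)
  _ _ _ c) => [||p z].
- exact: (additive_comp (mconvBr or mrr _) (mconvBr o23 m23r _)).
- exact: mconvBr.
rewrite !mconvUU // -[<< x *g k >>]/(monalgO (Some k) x).
rewrite -[<< z *g p >>]/(monalgO (Some p) z) !mconvOO //= mA oA.
by case: (o12 k l).
Qed.

Lemma mpushB (G : zmodType) (K K' : choiceType) (h : K -> K') :
  additive (@mpush G K K' h).
Proof. by apply: mextB => k; apply: monalgU_additive. Qed.

Lemma mpushU (G : zmodType) (K K' : choiceType) (h : K -> K') k (x : G) :
  mpush h << x *g k >> = << x *g h k >>.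
Proof. by rewrite /mpush mextU // => l; apply: monalgU_additive. Qed.

Lemma mcmapE (G H : zmodType) (K : choiceType) (phi : G -> H) :
  additive phi -> forall (u : {malg G[K]}) k, (mcmap phi u)@_k = phi u@_k.
Proof.
move=> phiB u k; pose F l x : {malg H[K]} := << phi x *g l >>.
have FB l : additive (F l) by move=> x y; rewrite /F /= phiB monalgU_additive.
apply: (@malg_additive_ext _ _ _ (fun u => (mcmap phi u)@_k)
  (fun u => phi u@_k) _ _ _ u) => [||l x].
- by move=> v w; rewrite /= /mcmap (mextB FB) mcoeffB.
- by move=> v w; rewrite /= mcoeffB phiB.
rewrite /mcmap (mextU _ _ FB) /F !mcoeffU; case: eqP => // _.
by rewrite !mulr0n; have := phiB 0 0; rewrite !subrr.
Qed.

Lemma mcmapB (G H : zmodType) (K : choiceType) (phi : G -> H) :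
  additive phi -> additive (@mcmap G H K phi).
Proof.
by move=> phiB; apply: mextB => k x y; rewrite /= phiB monalgU_additive.
Qed.

Lemma mcmapO (G H : zmodType) (K : choiceType) (phi : G -> H) :
  additive phi -> forall (o : option K) x,
  mcmap phi (monalgO o x) = monalgO o (phi x).
Proof.
move=> phiB o x; apply/malgP => k; rewrite mcmapE //.
have phi0 : phi 0 = 0 by have := phiB 0 0; rewrite !subrr.
by case: o => [l|] /=; rewrite ?mcoeff0 ?mcoeffU //; case: eqP.
Qed.

Lemma mcmap_id (G : zmodType) (K : choiceType) (u : {malg G[K]}) :
  mcmap id u = u.
Proof. by apply/malgP => k; rewrite mcmapE. Qed.

Lemma mcmap_mconv (G1 G2 G3 H1 H2 H3 : zmodType) (K1 K2 K3 : choiceType)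
    (mu : G1 -> G2 -> G3) (nu : H1 -> H2 -> H3) (o : K1 -> K2 -> option K3)
    (phi1 : G1 -> H1) (phi2 : G2 -> H2) (phi3 : G3 -> H3) :
  (forall y, additive (fun x => mu x y)) -> (forall x, additive (mu x)) ->
  (forall y, additive (fun x => nu x y)) -> (forall x, additive (nu x)) ->
  additive phi1 -> additive phi2 -> additive phi3 ->
  (forall x y, phi3 (mu x y) = nu (phi1 x) (phi2 y)) ->
  forall a b,
  mcmap phi3 (mconv mu o a b) = mconv nu o (mcmap phi1 a) (mcmap phi2 b).
Proof.
move=> mul mur nul nur p1 p2 p3 eqp a b.
apply: (@malg_additive_ext _ _ _
  (fun a => mcmap phi3 (mconv mu o a b))
  (fun a => mconv nu o (mcmap phi1 a) (mcmap phi2 b)) _ _ _ a) => [||k x].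
- exact: (additive_comp (mcmapB p3) (mconvBl o mul b)).
- exact: (additive_comp (mconvBl o nul _) (mcmapB p1)).
apply: (@malg_additive_ext _ _ _
  (fun b => mcmap phi3 (mconv mu o << x *g k >> b))
  (fun b => mconv nu o (mcmap phi1 << x *g k >>) (mcmap phi2 b))
  _ _ _ b) => [||l y].
- exact: (additive_comp (mcmapB p3) (mconvBr o mur _)).
- exact: (additive_comp (mconvBr o nur _) (mcmapB p2)).
rewrite mconvUU // mcmapO // -[<< x *g k >>]/(monalgO (Some k) x).
by rewrite -[<< y *g l >>]/(monalgO (Some l) y) !mcmapO // mconvUU // eqp.
Qed.

HB.mixin Record Zmodule_isBimodule (R R' : pzRingType) M of GRing.Zmodule M := {
  lact : R -> M -> M;
  ract : M -> R' -> M;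
  lactDl : forall m, {morph lact^~ m : r s / r + s};
  lactDr : forall r, {morph lact r : m n / m + n};
  lactA : forall r s m, lact r (lact s m) = lact (r * s) m;
  lact1 : forall m, lact 1 m = m;
  ractDl : forall r, {morph ract^~ r : m n / m + n};
  ractDr : forall m, {morph ract m : r s / r + s};
  ractA : forall m r s, ract (ract m r) s = ract m (r * s);
  ract1 : forall m, ract m 1 = m;
  lractA : forall r m s, lact r (ract m s) = ract (lact r m) s }.

#[short(type="bimodType")]
HB.structure Definition Bimodule (R R' : pzRingType) :=
  {M of Zmodule_isBimodule R R' M & GRing.Zmodule M}.

Definition bimod_morphism (R R' : pzRingType) (M N : bimodType R R')
    (phi : M -> N) : Prop :=
  [/\ {morph phi : m n / m + n},
      forall (r : R) m, phi (lact r m) = lact r (phi m) &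
      forall m (r : R'), phi (ract m r) = ract (phi m) r].

HB.mixin Record Lmodule_isNonUnitalAlgebra (R : pzRingType) A
    of GRing.Lmodule R A := {
  amul : A -> A -> A;
  amulA : associative amul;
  amulDl : left_distributive amul +%R;
  amulDr : right_distributive amul +%R;
  amulZl : forall (r : R) a b, amul (r *: a) b = r *: amul a b;
  amulZr : forall (r : R) a b, amul a (r *: b) = r *: amul a b }.

#[short(type="nuAlgType")]
HB.structure Definition NonUnitalAlgebra (R : pzRingType) :=
  {A of Lmodule_isNonUnitalAlgebra R A & GRing.Lmodule R A}.

Definition alg_morphism (R : pzRingType) (A B : nuAlgType R) (phi : A -> B) :
    Prop :=
  linear phi /\ {morph phi : a b / amul a b}.

HB.mixin Record Bimodule_isAlgBimodule (R R' : pzRingType)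
    (A : nuAlgType R) (A' : nuAlgType R') M of Bimodule R R' M := {
  alact : A -> M -> M;
  aract : M -> A' -> M;
  alactDl : forall m, {morph alact^~ m : a b / a + b};
  alactDr : forall a, {morph alact a : m n / m + n};
  alactZ : forall (r : R) a m, alact (r *: a) m = lact r (alact a m);
  alact_lact : forall a (r : R) m, alact a (lact r m) = lact r (alact a m);
  alact_ract : forall a m (r : R'), alact a (ract m r) = ract (alact a m) r;
  alactA : forall a b m, alact a (alact b m) = alact (amul a b) m;
  aractDl : forall a, {morph aract^~ a : m n / m + n};
  aractDr : forall m, {morph aract m : a b / a + b};
  aractZ : forall m (r : R') a, aract m (r *: a) = ract (aract m a) r;
  aract_ract : forall m (r : R') a, aract (ract m r) a = ract (aract m a) r;
  aract_lact : forall (r : R) m a, aract (lact r m) a = lact r (aract m a);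
  aractA : forall m a b, aract (aract m a) b = aract m (amul a b);
  alractA : forall a m b, alact a (aract m b) = aract (alact a m) b }.

#[short(type="algBimodType")]
HB.structure Definition AlgBimodule (R R' : pzRingType)
    (A : nuAlgType R) (A' : nuAlgType R') :=
  {M of Bimodule_isAlgBimodule R R' A A' M & Bimodule R R' M}.

Section Tensor.
Variables R R' : pzRingType.

Local Notation F := {malg int[(R * R')%type]}.
Local Notation gen x y := (<< 1%:Z *g (x, y) >> : F).

(* The subgroup of the free abelian group on R x R' generated by the
   biadditivity relations; balancedness over the integers follows. *)
Inductive tens_rel : F -> Prop :=
| tens_relDl x x' y : tens_rel (gen (x + x') y - gen x y - gen x' y)
| tens_relDr x y y' : tens_rel (gen x (y + y') - gen x y - gen x y')
| tens_rel0 : tens_rel 0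
| tens_relB u v : tens_rel u -> tens_rel v -> tens_rel (u - v).

Definition tens_null : {pred F} := fun u => `[< tens_rel u >].

Lemma tens_null_closed : zmod_closed tens_null.
Proof.
split=> [|u v /asboolP ? /asboolP ?]; apply/asboolP; first exact: tens_rel0.
exact: tens_relB.
Qed.

HB.instance Definition _ :=
  GRing.isZmodClosed.Build F tens_null tens_null_closed.

Definition tens : Type := Quotient.quot tens_null.

HB.instance Definition _ := GRing.Zmodule.on tens.

Definition tens_pi (u : F) : tens := \pi_(Quotient.quot tens_null)%qT u.

Definition tensor (x : R) (y : R') : tens := tens_pi (gen x y).

Lemma tens_piB : additive tens_pi.
Proof. by move=> u v; rewrite /tens_pi !piE. Qed.

Lemma tens_pi_eq0 u : tens_rel u -> tens_pi u = 0.
Proof.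
move=> u0; rewrite -[RHS](subrr (tens_pi 0)) -tens_piB subrr.
apply/eqP; rewrite /tens_pi -Quotient.idealrBE subr0; exact/asboolP.
Qed.

Lemma tens_pi_inj u v : tens_pi u = tens_pi v -> tens_rel (u - v).
Proof.
by move/eqP; rewrite /tens_pi -Quotient.idealrBE => /asboolP.
Qed.

Lemma tensorDl x x' y : tensor (x + x') y = tensor x y + tensor x' y.
Proof.
apply/eqP; rewrite -subr_eq0 opprD addrA -!tens_piB; apply/eqP.
exact/tens_pi_eq0/tens_relDl.
Qed.

Lemma tensorDr x y y' : tensor x (y + y') = tensor x y + tensor x y'.
Proof.
apply/eqP; rewrite -subr_eq0 opprD addrA -!tens_piB; apply/eqP.
exact/tens_pi_eq0/tens_relDr.
Qed.

Lemma tens_ext (V : zmodType) (f g : tens -> V) : additive f -> additive g ->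
  (forall x y, f (tensor x y) = g (tensor x y)) -> f =1 g.
Proof.
move=> fB gB eqfg t; rewrite -[t]reprK.
apply: (@malg_additive_ext _ _ _ (fun u => f (tens_pi u))
  (fun u => g (tens_pi u)) _ _ _ (repr t)) => [||p z].
- exact: (additive_comp fB tens_piB).
- exact: (additive_comp gB tens_piB).
have Z_ext (h : int -> V) : additive h -> forall z, h z = h 1 *~ z.
  move=> hB n; pose h' := GRing.isAdditive.Build _ _ h hB.
  pose hA : {additive int -> V} := HB.pack h h'.
  by rewrite -[h]/(hA : _ -> _) -raddfMz mulrzz mul1r.
have pB := additive_comp tens_piB (monalgU_additive p).
rewrite (Z_ext _ (additive_comp fB pB)) (Z_ext _ (additive_comp gB pB)).
by case: p {pB} => x y; rewrite [X in X *~ _]eqfg.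
Qed.

(* x (x) y |-> h (x, y), when h preserves the biadditivity relations. *)
Definition tens_map (h : R * R' -> R * R') (t : tens) : tens :=
  tens_pi (mpush h (repr t)).

Definition tens_compat (h : R * R' -> R * R') : Prop :=
  forall u : F, tens_rel u -> tens_rel (mpush h u).

Lemma tens_map_pi h u : tens_compat h ->
  tens_map h (tens_pi u) = tens_pi (mpush h u).
Proof.
move=> hP; apply/eqP; rewrite -subr_eq0 -tens_piB -mpushB; apply/eqP.
apply/tens_pi_eq0/hP/tens_pi_inj.
by rewrite /tens_pi reprK.
Qed.

Lemma tens_mapB h : tens_compat h -> additive (tens_map h).
Proof.
move=> hP s t; rewrite -[s]reprK -[t]reprK -!/(tens_pi _) -tens_piB.
by rewrite !tens_map_pi // mpushB tens_piB.
Qed.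

Lemma tens_map_tensor h x y : tens_compat h ->
  tens_map h (tensor x y) = tensor (h (x, y)).1 (h (x, y)).2.
Proof.
by move=> hP; rewrite /tensor tens_map_pi // mpushU -surjective_pairing.
Qed.

Lemma tens_compat_l r : tens_compat (fun p => (r * p.1, p.2)).
Proof.
move=> u; elim=> {u} [x x' y|x y y'||u v _ IHu _ IHv]; rewrite ?mpushB ?mpushU /=.
- by rewrite mulrDr; apply: tens_relDl.
- exact: tens_relDr.
- by rewrite -(subrr 0) mpushB subrr; apply: tens_rel0.
- exact: tens_relB.
Qed.

Lemma tens_compat_r r : tens_compat (fun p => (p.1, p.2 * r)).
Proof.
move=> u; elim=> {u} [x x' y|x y y'||u v _ IHu _ IHv]; rewrite ?mpushB ?mpushU /=.
- exact: tens_relDl.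
- by rewrite mulrDl; apply: tens_relDr.
- by rewrite -(subrr 0) mpushB subrr; apply: tens_rel0.
- exact: tens_relB.
Qed.

Definition tens_lact (r : R) : tens -> tens :=
  tens_map (fun p => (r * p.1, p.2)).
Definition tens_ract (t : tens) (r : R') : tens :=
  tens_map (fun p => (p.1, p.2 * r)) t.

Lemma tens_lact_tensor r x y : tens_lact r (tensor x y) = tensor (r * x) y.
Proof. exact/tens_map_tensor/tens_compat_l. Qed.

Lemma tens_ract_tensor x y r : tens_ract (tensor x y) r = tensor x (y * r).
Proof. exact: (tens_map_tensor _ _ (tens_compat_r r)). Qed.

Let lB r : additive (tens_lact r). Proof. exact/tens_mapB/tens_compat_l. Qed.
Let rB r : additive (tens_ract^~ r). Proof. exact/tens_mapB/tens_compat_r. Qed.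

Let addB (V : zmodType) (f g : tens -> V) : additive f -> additive g ->
  additive (fun x => f x + g x).
Proof. by move=> fB gB x y; rewrite fB gB opprD addrACA. Qed.

Lemma tens_lactDl t : {morph tens_lact^~ t : r s / r + s}.
Proof.
move=> r s; move: t; apply: tens_ext => // [|x y]; first exact: addB.
by rewrite !tens_lact_tensor mulrDl tensorDl.
Qed.

Lemma tens_lactA r s t : tens_lact r (tens_lact s t) = tens_lact (r * s) t.
Proof.
move: t; apply: tens_ext => // [|x y]; first exact: (additive_comp (lB r) (lB s)).
by rewrite !tens_lact_tensor mulrA.
Qed.

Lemma tens_lact1 t : tens_lact 1 t = t.
Proof.
move: t; apply: (@tens_ext _ _ (fun t => t)) => // x y.
by rewrite tens_lact_tensor mul1r.
Qed.

Lemma tens_ractDr t : {morph tens_ract t : r s / r + s}.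
Proof.
move=> r s; move: t; apply: (@tens_ext _ (tens_ract^~ (r + s))
  (fun t => tens_ract t r + tens_ract t s)) => // [|x y]; first exact: addB.
by rewrite !tens_ract_tensor mulrDr tensorDr.
Qed.

Lemma tens_ractA t r s : tens_ract (tens_ract t r) s = tens_ract t (r * s).
Proof.
move: t; apply: (@tens_ext _ (fun t => tens_ract (tens_ract t r) s)
  (tens_ract^~ (r * s))) => // [|x y].
  exact: (additive_comp (rB s) (rB r)).
by rewrite !tens_ract_tensor mulrA.
Qed.

Lemma tens_ract1 t : tens_ract t 1 = t.
Proof.
move: t; apply: (@tens_ext _ (tens_ract^~ 1) (fun t => t)) => // x y.
by rewrite tens_ract_tensor mulr1.
Qed.

Lemma tens_lractA r t s :
  tens_lact r (tens_ract t s) = tens_ract (tens_lact r t) s.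
Proof.
move: t; apply: (@tens_ext _ (fun t => tens_lact r (tens_ract t s))
  (fun t => tens_ract (tens_lact r t) s)) => [||x y].
- exact: (additive_comp (lB r) (rB s)).
- exact: (additive_comp (rB s) (lB r)).
by rewrite !(tens_ract_tensor, tens_lact_tensor).
Qed.

HB.instance Definition _ := Zmodule_isBimodule.Build R R' tens
  tens_lactDl (fun r => additiveD (lB r)) tens_lactA tens_lact1
  (fun r => additiveD (rB r)) tens_ractDr tens_ractA tens_ract1 tens_lractA.

End Tensor.

Definition dsum (R R' : pzRingType) (M : bimodType R R') (K : choiceType) :
  Type := {malg M[K]}.

Section DirectSum.
Variables (R R' : pzRingType) (M : bimodType R R') (K : choiceType).

Local Notation D := (dsum M K).

HB.instance Definition _ := GRing.Zmodule.on D.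

Definition dsum_lact (r : R) (u : D) : D := mcmap (lact r) u.
Definition dsum_ract (u : D) (r : R') : D := mcmap (fun x => ract x r) u.

Lemma lactB r : additive (lact r : M -> M).
Proof. exact/morphD_additive/lactDr. Qed.

Lemma ractB r : additive (fun x : M => ract x r).
Proof. exact/morphD_additive/ractDl. Qed.

Lemma dsum_lactE r (u : D) k : (dsum_lact r u)@_k = lact r u@_k.
Proof. exact/mcmapE/lactB. Qed.

Lemma dsum_ractE r (u : D) k : (dsum_ract u r)@_k = ract u@_k r.
Proof. exact/(mcmapE (ractB r)). Qed.

Lemma dsum_lactDl (u : D) : {morph dsum_lact^~ u : r s / r + s}.
Proof.
by move=> r s; apply/malgP => k; rewrite mcoeffD !dsum_lactE lactDl.
Qed.

Lemma dsum_lactDr r : {morph dsum_lact r : u v / u + v}.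
Proof.
by move=> u v; apply/malgP => k; rewrite mcoeffD !dsum_lactE mcoeffD lactDr.
Qed.

Lemma dsum_lactA r s u : dsum_lact r (dsum_lact s u) = dsum_lact (r * s) u.
Proof. by apply/malgP => k; rewrite !dsum_lactE lactA. Qed.

Lemma dsum_lact1 u : dsum_lact 1 u = u.
Proof. by apply/malgP => k; rewrite dsum_lactE lact1. Qed.

Lemma dsum_ractDl r : {morph dsum_ract^~ r : u v / u + v}.
Proof.
by move=> u v; apply/malgP => k; rewrite mcoeffD !dsum_ractE mcoeffD ractDl.
Qed.

Lemma dsum_ractDr u : {morph dsum_ract u : r s / r + s}.
Proof.
by move=> r s; apply/malgP => k; rewrite mcoeffD !dsum_ractE ractDr.
Qed.

Lemma dsum_ractA u r s : dsum_ract (dsum_ract u r) s = dsum_ract u (r * s).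
Proof. by apply/malgP => k; rewrite !dsum_ractE ractA. Qed.

Lemma dsum_ract1 u : dsum_ract u 1 = u.
Proof. by apply/malgP => k; rewrite dsum_ractE ract1. Qed.

Lemma dsum_lractA r u s :
  dsum_lact r (dsum_ract u s) = dsum_ract (dsum_lact r u) s.
Proof. by apply/malgP => k; rewrite !(dsum_lactE, dsum_ractE) lractA. Qed.

HB.instance Definition _ := Zmodule_isBimodule.Build R R' D
  dsum_lactDl dsum_lactDr dsum_lactA dsum_lact1
  dsum_ractDl dsum_ractDr dsum_ractA dsum_ract1 dsum_lractA.

End DirectSum.

(* monalg's own module structure on {malg R[K]} excludes the zero ring. *)
Definition path_alg (R : comPzRingType) (S : secat) : Type :=
  {malg R[simplex S 0]}.

Section PathAlgebra.
Variables (R : comPzRingType) (S : secat).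

Local Notation A := (path_alg R S).

HB.instance Definition _ := GRing.Zmodule.on A.

Definition path_scale (r : R) (a : A) : A := mcmap ( *%R r) a.

Lemma path_scaleE r a k : (path_scale r a)@_k = r * a@_k.
Proof. by apply: mcmapE => x y; rewrite mulrBr. Qed.

Lemma path_scaleA r s a : path_scale r (path_scale s a) = path_scale (r * s) a.
Proof. by apply/malgP => k; rewrite !path_scaleE mulrA. Qed.

Lemma path_scale1 : left_id 1 path_scale.
Proof. by move=> a; apply/malgP => k; rewrite path_scaleE mul1r. Qed.

Lemma path_scaleDr : right_distributive path_scale +%R.
Proof.
by move=> r a b; apply/malgP => k; rewrite mcoeffD !path_scaleE mcoeffD mulrDr.
Qed.

Lemma path_scaleDl a : {morph path_scale^~ a : r s / r + s}.
Proof.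
by move=> r s; apply/malgP => k; rewrite mcoeffD !path_scaleE mulrDl.
Qed.

HB.instance Definition _ := GRing.Zmodule_isLmodule.Build R A
  path_scaleA path_scale1 path_scaleDr path_scaleDl.

(* The R-bilinear product with g x f = g o_0 f, or 0 when not composable. *)
Definition path_mul (b a : A) : A := mconv *%R (@simplex_comp S 0) b a.

Let mulB (y : R) : additive (fun x : R => x * y).
Proof. by move=> x z; rewrite /= mulrBl. Qed.

Let murB (x : R) : additive ( *%R x).
Proof. by move=> y z; rewrite mulrBr. Qed.

Lemma path_mulA : associative path_mul.
Proof.
move=> a b c; apply: mconvA => // [x y z|h g f]; first exact: mulrA.
exact: simplex_compA.
Qed.

Lemma path_mulDl : left_distributive path_mul +%R.
Proof. by move=> a b c; apply: (additiveD (mconvBl _ mulB c)). Qed.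

Lemma path_mulDr : right_distributive path_mul +%R.
Proof. by move=> a b c; apply: (additiveD (mconvBr _ murB a)). Qed.

Lemma path_mulZl (r : R) a b : path_mul (r *: a) b = r *: path_mul a b.
Proof.
rewrite -{1}(mcmap_id b); apply/esym.
by apply: mcmap_mconv => // x y; rewrite mulrA.
Qed.

Lemma path_mulZr (r : R) a b : path_mul a (r *: b) = r *: path_mul a b.
Proof.
rewrite -{1}(mcmap_id a); apply/esym.
by apply: mcmap_mconv => // x y; rewrite mulrCA.
Qed.

HB.instance Definition _ := Lmodule_isNonUnitalAlgebra.Build R A
  path_mulA path_mulDl path_mulDr path_mulZl path_mulZr.

End PathAlgebra.

Definition chains (R : comPzRingType) (S : secat) (R' : comPzRingType)
  (n : nat) : Type := dsum (tens R R') (simplex S n).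

Section Chains.
Variables (R : comPzRingType) (S : secat) (R' : comPzRingType) (n : nat).

Local Notation C := (chains R S R' n).
Local Notation T := (tens R R').

HB.instance Definition _ := Bimodule.on C.

Definition chain_basis (s : simplex S n) : C := << tensor 1 1 *g s >>.

Definition chain_lact (a : path_alg R S) (m : C) : C :=
  mconv (fun (r : R) (t : T) => lact r t)
    (fun (f : simplex S 0) s => simplex_comp (simplex_deg n f) s) a m.

Definition chain_ract (m : C) (b : path_alg R' S) : C :=
  mconv (fun (t : T) (r : R') => ract t r)
    (fun s (g : simplex S 0) => simplex_comp s (simplex_deg n g)) m b.

Let llB (t : T) : additive (fun r : R => lact r t).
Proof. exact/morphD_additive/lactDl. Qed.

Let lrB (r : R) : additive (fun t : T => lact r t).
Proof. exact: lactB. Qed.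

Let rlB (r : R') : additive (fun t : T => ract t r).
Proof. exact: ractB. Qed.

Let rrB (t : T) : additive (fun r : R' => ract t r).
Proof. exact/morphD_additive/ractDr. Qed.

Let idB (V : zmodType) : additive (fun x : V => x).
Proof. by []. Qed.

Let scaleB (A : comPzRingType) (x : A) : additive (fun y => x * y).
Proof. by move=> y z; rewrite /= mulrBr. Qed.

Let scaleBl (A : comPzRingType) (y : A) : additive (fun x => x * y).
Proof. by move=> x z; rewrite /= mulrBl. Qed.

Lemma chain_lactDl m : {morph chain_lact^~ m : a b / a + b}.
Proof. exact: (additiveD (mconvBl _ llB m)). Qed.

Lemma chain_lactDr a : {morph chain_lact a : m p / m + p}.
Proof. exact: (additiveD (mconvBr _ lrB a)). Qed.

Lemma chain_ractDl b : {morph chain_ract^~ b : m p / m + p}.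
Proof. exact: (additiveD (mconvBl _ rlB b)). Qed.

Lemma chain_ractDr m : {morph chain_ract m : a b / a + b}.
Proof. exact: (additiveD (mconvBr _ rrB m)). Qed.

Lemma chain_lactZ (r : R) a m :
  chain_lact (r *: a) m = lact r (chain_lact a m).
Proof.
rewrite -{1}(mcmap_id m); apply/esym.
have H x (t : T) : lact r (lact x t) = lact (r * x) t by rewrite lactA.
exact: (mcmap_mconv _ llB lrB llB lrB (@scaleB R r) (@idB T) (lrB r) H a m).
Qed.

Lemma chain_lact_lact a (r : R) m :
  chain_lact a (lact r m) = lact r (chain_lact a m).
Proof.
rewrite -{1}(mcmap_id a); apply/esym.
have H x (t : T) : lact r (lact x t) = lact x (lact r t).
  by rewrite !lactA mulrC.
exact: (mcmap_mconv _ llB lrB llB lrB (@idB R) (lrB r) (lrB r) H a m).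
Qed.

Lemma chain_lact_ract a m (r : R') :
  chain_lact a (ract m r) = ract (chain_lact a m) r.
Proof.
rewrite -{1}(mcmap_id a); apply/esym.
have H (x : R) (t : T) : ract (lact x t) r = lact x (ract t r).
  by rewrite lractA.
exact: (mcmap_mconv _ llB lrB llB lrB (@idB R) (rlB r) (rlB r) H a m).
Qed.

Lemma chain_lactA a b m :
  chain_lact a (chain_lact b m) = chain_lact (amul a b) m.
Proof.
apply: (mconvA (@scaleBl R) (@scaleB R) llB lrB llB lrB llB lrB (@lactA _ _ T)).
by move=> f g s; rewrite simplex_compA simplex_comp_deg; case: (simplex_comp f g).
Qed.

Lemma chain_ractZ m (r : R') b :
  chain_ract m (r *: b) = ract (chain_ract m b) r.
Proof.
rewrite -{1}(mcmap_id m); apply/esym.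
have H (t : T) x : ract (ract t x) r = ract t (r * x).
  by rewrite ractA mulrC.
exact: (mcmap_mconv _ rlB rrB rlB rrB (@idB T) (@scaleB R' r) (rlB r) H m b).
Qed.

Lemma chain_ract_ract m (r : R') b :
  chain_ract (ract m r) b = ract (chain_ract m b) r.
Proof.
rewrite -{1}(mcmap_id b); apply/esym.
have H (t : T) x : ract (ract t x) r = ract (ract t r) x.
  by rewrite !ractA mulrC.
exact: (mcmap_mconv _ rlB rrB rlB rrB (rlB r) (@idB R') (rlB r) H m b).
Qed.

Lemma chain_ract_lact (r : R) m b :
  chain_ract (lact r m) b = lact r (chain_ract m b).
Proof.
rewrite -{1}(mcmap_id b); apply/esym.
have H (t : T) (x : R') : lact r (ract t x) = ract (lact r t) x.
  by rewrite lractA.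
exact: (mcmap_mconv _ rlB rrB rlB rrB (lrB r) (@idB R') (lrB r) H m b).
Qed.

Lemma chain_ractA m a b :
  chain_ract (chain_ract m a) b = chain_ract m (amul a b).
Proof.
have H (t : T) x y : ract t (x * y) = ract (ract t x) y by rewrite ractA.
apply/esym.
apply: (mconvA rlB rrB (@scaleBl R') (@scaleB R') rlB rrB rlB rrB H) => s f g.
by rewrite -simplex_compA simplex_comp_deg; case: (simplex_comp f g).
Qed.

Lemma chain_lractA a m b :
  chain_lact a (chain_ract m b) = chain_ract (chain_lact a m) b.
Proof.
have H x (t : T) y : lact x (ract t y) = ract (lact x t) y by rewrite lractA.
apply: (mconvA llB lrB rlB rrB rlB rrB llB lrB H) => f s g.
exact: simplex_compA.
Qed.

HB.instance Definition _ :=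
  Bimodule_isAlgBimodule.Build R R' (path_alg R S) (path_alg R' S) C
    chain_lactDl chain_lactDr chain_lactZ chain_lact_lact chain_lact_ract
    chain_lactA chain_ractDl chain_ractDr chain_ractZ chain_ract_ract
    chain_ract_lact chain_ractA chain_lractA.

(* f.s.g for 1-morphisms f and g and a basis simplex s *)
Lemma alract_basis (f g : simplex S 0) (s : simplex S n) :
  alact (<< 1 *g f >> : path_alg R S)
    (aract (chain_basis s) (<< 1 *g g >> : path_alg R' S)) =
  if obind (fun u => simplex_comp (simplex_deg n f) u)
       (simplex_comp s (simplex_deg n g)) is Some u
  then chain_basis u else 0.
Proof.
rewrite [aract _ _]mconvUU // ract1 -[X in alact X]/(monalgO (Some f) 1).
rewrite [alact _ _]mconvOO //= lact1.
by case: (simplex_comp s _) => //= u; case: (simplex_comp _ _).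
Qed.

End Chains.

Definition chain_map (R R' : comPzRingType) (S T : secat) (f : sefun S T) n :
    chains R S R' n -> chains R T R' n :=
  mpush (@simplex_map S T f n).

Definition path_alg_map (R : comPzRingType) (S T : secat) (f : sefun S T) :
    path_alg R S -> path_alg R T :=
  mpush (@simplex_map S T f 0).

Arguments chain_map R R' {S T} f n m.
Arguments path_alg_map R {S T} f a.

(* Main.v *)
Require Import Defs.
From HB Require Import structures.
From mathcomp Require Import all_boot all_order all_algebra.
From mathcomp Require Import finmap boolp.
From mathcomp Require Import monalg.

Set Implicit Arguments.
Unset Strict Implicit.
Unset Printing Implicit Defensive.

Import GRing.Theory.
Local Open Scope ring_scope.

(** Every induced map here is a pushforward of finitely supported functions along [simplex_map f]:
    keys move, coefficients are carried along and added where keys collide. Scalars act on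
    coefficients only, so linearity on either side is the commutation [mpush_mcmap], and
    functoriality is that of pushforward ([mpush_comp], [mpush_id]). The product of the path algebra
    and its two actions on chains are convolutions along a partial composition of keys. By
    [mpush_mconv], pushforward respects a convolution as soon as the key maps respect the partial
    composition, its domain of definition included. This is [simplex_map_comp]: functors preserve
    composites, and injectivity on objects keeps zero products zero. *)

Section Pushforward.
Variables (G : zmodType) (K K' : choiceType).
Implicit Types u : {malg G[K]}.

(** [mpush id] and [mcmap id] unfold to the same [mext]. *)
Lemma mpush_id u : mpush id u = u.
Proof. exact: mcmap_id. Qed.

Lemma eq_mpush (h k : K -> K') : h =1 k -> @mpush G K K' h =1 mpush k.
Proof. by move=> eqhk u; apply: eq_bigr => i _; rewrite eqhk. Qed.

Lemma mpush_comp (K'' : choiceType) (h : K' -> K'') (k : K -> K') u :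
  mpush (fun x => h (k x)) u = mpush h (mpush k u).
Proof.
apply: (@malg_additive_ext _ _ _ (mpush (fun x => h (k x)))
  (fun v => mpush h (mpush k v)) _ _ _ u) => [||i x].
- exact: mpushB.
- exact: (additive_comp (mpushB h) (mpushB k)).
- by rewrite !mpushU.
Qed.

Lemma mpushO (h : K -> K') (o : option K) (x : G) :
  mpush h (monalgO o x) = monalgO (omap h o) x.
Proof.
case: o => [k|] /=; first exact: mpushU.
(* Additivity is stated with differences; at 0 - 0 it says that 0, the value of an undefined
   composite, is preserved. *)
by have := mpushB h (0 : {malg G[K]}) 0; rewrite !subrr.
Qed.

Lemma mpush_mcmap (H : zmodType) (phi : G -> H) (h : K -> K') u :
  additive phi -> mpush h (mcmap phi u) = mcmap phi (mpush h u).
Proof.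
move=> phiB; apply: (@malg_additive_ext _ _ _
  (fun v => mpush h (mcmap phi v)) (fun v => mcmap phi (mpush h v))
  _ _ _ u) => [||k x].
- exact: (additive_comp (mpushB h) (mcmapB phiB)).
- exact: (additive_comp (mcmapB phiB) (mpushB h)).
rewrite mpushU -[<< x *g k >>]/(monalgO (Some k) x) mcmapO //= mpushU.
by rewrite -[<< x *g h k >>]/(monalgO (Some (h k)) x) mcmapO.
Qed.

End Pushforward.

(** Both sides are additive in [a] and in [b], so monomials suffice, where the claim is the
    hypothesis on keys. As an equality of options, that hypothesis also forces undefined composites
    to stay undefined. *)
Lemma mpush_mconv (G1 G2 G3 : zmodType) (K1 K2 K3 L1 L2 L3 : choiceType)
    (mu : G1 -> G2 -> G3) (o : K1 -> K2 -> option K3)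
    (o' : L1 -> L2 -> option L3)
    (h1 : K1 -> L1) (h2 : K2 -> L2) (h3 : K3 -> L3) :
  (forall y, additive (fun x => mu x y)) -> (forall x, additive (mu x)) ->
  (forall k l, o' (h1 k) (h2 l) = omap h3 (o k l)) ->
  forall a b,
  mpush h3 (mconv mu o a b) = mconv mu o' (mpush h1 a) (mpush h2 b).
Proof.
move=> mul mur eqo a b.
apply: (@malg_additive_ext _ _ _
  (fun a => mpush h3 (mconv mu o a b))
  (fun a => mconv mu o' (mpush h1 a) (mpush h2 b)) _ _ _ a) => [||k x].
- exact: (additive_comp (mpushB h3) (mconvBl o mul b)).
- exact: (additive_comp (mconvBl o' mul _) (mpushB h1)).
apply: (@malg_additive_ext _ _ _
  (fun b => mpush h3 (mconv mu o << x *g k >> b))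
  (fun b => mconv mu o' (mpush h1 << x *g k >>) (mpush h2 b))
  _ _ _ b) => [||l y].
- exact: (additive_comp (mpushB h3) (mconvBr o mur _)).
- exact: (additive_comp (mconvBr o' mur _) (mpushB h2)).
by rewrite !mpushU !mconvUU // mpushO eqo.
Qed.

(** Naturality of [p] with respect to each codegeneracy, iterated. *)
Lemma deg_iter_smap (X Y : sset) (p : smap X Y) n (x : X 0) :
  p n (deg_iter n x) = deg_iter n (p 0 x).
Proof. by elim: n => //= n <-; rewrite /sdeg smap_nat. Qed.

Section SimplexMap.
Variables (S T : secat) (f : sefun S T).

Lemma simplex_map_deg n (s : simplex S 0) :
  simplex_map f (simplex_deg n s) = simplex_deg n (simplex_map f s).
Proof. by rewrite /simplex_map /simplex_deg /= deg_iter_smap. Qed.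

(* Injectivity on objects is needed so that non-composable simplices do not
   become composable in T. *)
Lemma simplex_map_comp n (t s : simplex S n) : injective (fob f) ->
  simplex_comp (simplex_map f t) (simplex_map f s) =
  omap (@simplex_map S T f n) (simplex_comp t s).
Proof.
move=> f_inj; case: t s => [B' C t] [A B s].
have [e|ne] := pselect (B = B').
  (* Eliminating the equality of objects removes the transport, leaving functoriality on
     hom-objects. *)
  by case: B' / e t => t; rewrite !simplex_compE /= /simplex_map /= fhom_comp.
by rewrite !simplex_compN //= => /f_inj.
Qed.

End SimplexMap.

Lemma simplex_map_id (S : secat) n : @simplex_map S S (sefun_id S) n =1 id.
Proof. by case. Qed.

Section ChainMap.
Variables (R R' : comPzRingType) (S T : secat) (f : sefun S T) (n : nat).

Lemma chain_map_bimod : bimod_morphism (chain_map R R' f n).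
Proof.
split=> [|r m|m r]; first exact: (additiveD (mpushB _)).
(* The scalar action on chains is [mcmap] of the action on the tensor product. *)
- exact: (mpush_mcmap _ _ (lactB r)).
- exact: (mpush_mcmap _ _ (ractB r)).
Qed.

Lemma chain_map_comp (U : secat) (g : sefun T U) m :
  chain_map R R' (sefun_comp g f) n m =
  chain_map R R' g n (chain_map R R' f n m).
Proof. exact: mpush_comp. Qed.

Lemma chain_map_id m : chain_map R R' (sefun_id S) n m = m.
Proof.
rewrite /chain_map (eq_mpush (@simplex_map_id S n)); exact: mpush_id.
Qed.

(** The action is a convolution along composition with degenerate simplices; [f] commutes with
    degeneracies and, being injective on objects, with partial composition. *)
Lemma chain_map_alact (a : path_alg R S) m : injective (fob f) ->
  chain_map R R' f n (alact a m) =
  alact (path_alg_map R f a) (chain_map R R' f n m).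
Proof.
move=> f_inj; apply: mpush_mconv => [t|r|t s].
- exact/morphD_additive/lactDl.
- exact: lactB.
- by rewrite -simplex_map_deg simplex_map_comp.
Qed.

Lemma chain_map_aract m (b : path_alg R' S) : injective (fob f) ->
  chain_map R R' f n (aract m b) =
  aract (chain_map R R' f n m) (path_alg_map R' f b).
Proof.
move=> f_inj; apply: mpush_mconv => [r|t|s t].
- exact: ractB.
- exact/morphD_additive/ractDr.
- by rewrite -simplex_map_deg simplex_map_comp.
Qed.

End ChainMap.

Section PathAlgMap.
Variables (R : comPzRingType) (S T : secat) (f : sefun S T).

Lemma path_alg_map_morphism :
  injective (fob f) -> alg_morphism (path_alg_map R f).
Proof.
move=> f_inj; split=> [r a b|a b].
  rewrite /path_alg_map (additiveD (mpushB _)); congr (_ + _).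
  (* Scaling by [r] is coefficientwise multiplication, an instance of [mcmap]. *)
  by apply: mpush_mcmap => x y; rewrite mulrBr.
apply: mpush_mconv => [y x z|x y z|t s].
- by rewrite mulrBl.
- by rewrite mulrBr.
- exact: simplex_map_comp.
Qed.

Lemma path_alg_map_comp (U : secat) (g : sefun T U) a :
  path_alg_map R (sefun_comp g f) a = path_alg_map R g (path_alg_map R f a).
Proof. exact: mpush_comp. Qed.

Lemma path_alg_map_id a : path_alg_map R (sefun_id S) a = a.
Proof.
rewrite /path_alg_map (eq_mpush (@simplex_map_id S 0)); exact: mpush_id.
Qed.

End PathAlgMap.

Theorem theorem16 (R R' : comPzRingType) (S T : secat) (f : sefun S T)
    (n : nat) :
  [/\ bimod_morphism (chain_map R R' f n),
      forall s : simplex S n,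
        chain_map R R' f n (chain_basis R R' s) =
        chain_basis R R' (simplex_map f s),
      forall (U : secat) (g : sefun T U) (m : chains R S R' n),
        chain_map R R' (sefun_comp g f) n m =
        chain_map R R' g n (chain_map R R' f n m) &
      forall m : chains R S R' n, chain_map R R' (sefun_id S) n m = m] /\
  (injective (fob f) ->
    [/\ (* 1 *)
        [/\ alg_morphism (path_alg_map R f),
            alg_morphism (path_alg_map R' f),
            forall t : simplex S 0,
              path_alg_map R f << 1 *g t >> = << 1 *g simplex_map f t >> &
            forall t : simplex S 0,
              path_alg_map R' f << 1 *g t >> = << 1 *g simplex_map f t >>],
        (* 2 *)
        forall (a : path_alg R S) (b : path_alg R' S) (m : chains R S R' n),
          chain_map R R' f n (alact a m) =
            alact (path_alg_map R f a) (chain_map R R' f n m) /\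
          chain_map R R' f n (aract m b) =
            aract (chain_map R R' f n m) (path_alg_map R' f b) &
        (* 3 *)
        [/\ forall (U : secat) (g : sefun T U), injective (fob g) ->
              forall a : path_alg R S,
              path_alg_map R (sefun_comp g f) a = path_alg_map R g (path_alg_map R f a),
            forall (U : secat) (g : sefun T U), injective (fob g) ->
              forall b : path_alg R' S,
              path_alg_map R' (sefun_comp g f) b = path_alg_map R' g (path_alg_map R' f b),
            forall a : path_alg R S, path_alg_map R (sefun_id S) a = a &
            forall b : path_alg R' S, path_alg_map R' (sefun_id S) b = b]]).
Proof.
split=> [|f_inj]; split.
- exact: chain_map_bimod.
(* A basis chain is the monomial with coefficient [tensor 1 1], which pushforward leaves
   unchanged. *)
- by move=> s; apply: mpushU.
- exact: chain_map_comp.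
- exact: chain_map_id.
- by split; [exact: path_alg_map_morphism | exact: path_alg_map_morphism
            | move=> t; apply: mpushU | move=> t; apply: mpushU].
- by move=> a b m; rewrite chain_map_alact ?chain_map_aract.
- split=> [U g _|U g _||]; [exact: path_alg_map_comp
    | exact: path_alg_map_comp | exact: path_alg_map_id
    | exact: path_alg_map_id].
Qed.
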